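(* Let $A:X\to Y$, the ground truth distribution with variance coefficients $\Pi_n$, the noise $\nu=\nu_\delta$ of level $\delta>0$ with variance coefficients $\Delta_n(\delta)$, and the learned coefficients $\overline g(\delta)=(\overline g_n(\delta))_n$, $\overline g_n(\delta)=\frac{\sigma_n\Pi_n}{\sigma_n^2\Pi_n+\Delta_n(\delta)}$, be as specified in the context. (a) Let $u\in\mathcal N(A)^\perp$ satisfy $\langle u,u_n\rangle=0$ for all indices $n$ with $\Pi_n=0$. Then $$e(u,\delta):=\mathbb E_{\nu}\big(\|u-R(Au+\nu_\delta;\overline g(\delta))\|^2\big)\longrightarrow 0\quad\text{as }\delta\to0.$$ (b) Moreover, $$\overline e(\delta):=\mathbb E_{U,\nu}\big(\|U-R(AU+\nu_\delta;\overline g(\delta))\|^2\big)-\mathbb E_U\big(\|U_0\|^2\big)\longrightarrow0\quad\text{as }\delta\to0.$$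
   Context: $X$ and $Y$ are infinite-dimensional real Hilbert spaces, and $A:X\to Y$ is a compact linear operator with infinite-dimensional range and singular value expansion $Au=\sum_{n=1}^\infty\sigma_n\langle u,u_n\rangle v_n$. Here $\sigma_n>0$ are the singular values, assumed strictly decreasing (each of multiplicity one), $\{u_n\}$ is an orthonormal basis of $\mathcal N(A)^\perp$ and $\{v_n\}$ is an orthonormal basis of $\overline{\mathcal R(A)}$. The ground truth $U$ is an $X$-valued random variable with $\mathbb E(\|U\|^2)<\infty$; $U_0$ is its orthogonal projection onto $\mathcal N(A)$, and $\Pi_n:=\mathbb E(\langle U,u_n\rangle^2)$, so that $\sum_n\Pi_n<\infty$. For each noise level $\delta>0$ the noise $\nu_\delta$ is independent of $U$ and has zero mean; it enters only through its coefficients $\langle\nu_\delta,v_n\rangle$, which are real random variables with mean zero and second moment $\Delta_n(\delta):=\mathbb E(\langle\nu_\delta,v_n\rangle^2)$. (White noise $\Delta_n(\delta)=\delta^2$ is allowed, so $\nu_\delta$ need not take values in $Y$.) The noise level is defined by $\delta^2=\sup_{n\in\mathbb N}\Delta_n(\delta)$. It is assumed throughout that for every $n$ (and every $\delta>0$) $\Pi_n>0$ or $\Delta_n(\delta)>0$. For a real sequence $g=(g_n)$, $R(f;g)=\sum_{n=1}^\infty g_n\langle f,v_n\rangle u_n$. In particular $R(Au+\nu_\delta;g)=\sum_n g_n(\sigma_n\langle u,u_n\rangle+\langle\nu_\delta,v_n\rangle)u_n$, and $\|u-R(Au+\nu_\delta;g)\|^2=\|u_0\|^2+\sum_n\big((1-\sigma_ng_n)\langle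 u,u_n\rangle-g_n\langle\nu_\delta,v_n\rangle\big)^2$, where $u_0$ is the orthogonal projection of $u$ onto $\mathcal N(A)$. $\mathbb E_\nu$ is the expectation over the noise only (with $u$ fixed), and $\mathbb E_{U,\nu}$ is the expectation over the joint distribution of $U$ and $\nu_\delta$. *)

(* Defs.v *)
From HB Require Import structures.
From mathcomp Require Import all_boot all_order all_algebra.
From mathcomp Require Import all_classical all_reals all_analysis.

Set Implicit Arguments.
Unset Strict Implicit.
Unset Printing Implicit Defensive.

Import Order.TTheory GRing.Theory Num.Theory.
Import numFieldNormedType.Exports.

Local Open Scope classical_set_scope.
Local Open Scope ring_scope.

HB.mixin Record isHilbert (R : realType) X of CompleteNormedModule R X := {
  inner : {dot X for (@idfun R)} ;
  inner_norm : forall x : X, inner x x = `|x| ^+ 2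
}.

#[short(type="hilbertType")]
HB.structure Definition Hilbert (R : realType) :=
  { X of CompleteNormedModule R X & isHilbert R X }.

Section hilbert.
Context {R : realType} {X : hilbertType R}.
Implicit Types (D S : set X) (e : nat -> X).

Definition infinite_dimensional D : Prop :=
  ~ exists (n : nat) (b : 'I_n -> X),
      D `<=` [set x | exists c : 'I_n -> R, x = \sum_i c i *: b i].

Definition orth_compl S : set X := [set x | forall y, S y -> inner x y = 0].

(* The orthogonal projection onto a closed subspace [S]; [get] picks the
   unique such point. *)
Definition orth_proj S (x : X) : X :=
  get [set p | S p /\ orth_compl S (x - p)].

Definition lin_span e : set X :=
  [set x | exists (n : nat) (c : nat -> R), x = \sum_(i < n) c i *: e i].

(* Orthonormal (Hilbert) basis of the closed subspace [S]. *)
Definition orthonormal_basis S e : Prop :=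
  (forall m n, inner (e m) (e n) = (m == n)%:R) /\ closure (lin_span e) = S.

(* [|x - sum_n s_n|^2] for a vector series with partial sums [s], with value
   [+oo] when the series diverges: a finite integral of this function entails
   that the series converges almost everywhere. *)
Definition sq_dist_series (x : X) (s : X ^nat) : \bar R :=
  if `[< cvgn s >] then (`|x - limn s| ^+ 2)%:E else +oo%E.

End hilbert.

Section operators.
Context {R : realType} {X Y : hilbertType R}.

Definition null_space (A : X -> Y) : set X := A @^-1` [set 0].

Definition compact_operator (A : X -> Y) : Prop :=
  forall B : set X, bounded_set B -> precompact (A @` B).

Record singular_value_expansion (A : X -> Y) (sigma : nat -> R)
    (u : nat -> X) (v : nat -> Y) : Prop := {
  sve_pos : forall n, 0 < sigma n ;
  sve_decreasing : forall n, sigma n.+1 < sigma n ;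
  sve_basis_u : orthonormal_basis (orth_compl (null_space A)) u ;
  sve_basis_v : orthonormal_basis (closure (range A)) v ;
  sve_expansion : forall x,
    series (fun n => (sigma n * inner x (u n)) *: v n) @ \oo --> A x
}.

(* [R(f; g)] sees the datum [f] only through the coefficients
   [c n = <f, v_n>], so that [f] need not be an element of [Y]. *)
Definition reconstruction (u : nat -> X) (c g : nat -> R) : X ^nat :=
  series (fun n => (g n * c n) *: u n).

End operators.

Definition borel {R : realType} (X : hilbertType R) :=
  g_sigma_algebraType (@open X).

Section probability.
Context {R : realType} {X Y : hilbertType R} {d : measure_display}
  {Omega : measurableType d} (P : probability Omega R).
Implicit Types (U : Omega -> X) (nu : nat -> {RV P >-> R}).

Definition random_element U : Prop :=
  measurable_fun [set: Omega] (U : Omega -> borel X).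

Definition noise_sigma_algebra nu : set (set Omega) :=
  <<s \bigcup_n preimage_set_system [set: Omega] (nu n) measurable >>.

Definition independent_of_noise U nu : Prop :=
  forall (B : set (borel X)) (N : set Omega),
    measurable B -> noise_sigma_algebra nu N ->
    P (U @^-1` B `&` N) = (P (U @^-1` B) * P N)%E.

Definition signal_var U (u : nat -> X) (n : nat) : R :=
  fine 'E_P[fun w => inner (U w) (u n) ^+ 2].

Definition noise_var nu (n : nat) : \bar R := 'E_P[fun w => nu n w ^+ 2].

Definition learned_coef (sigma Pi Delta : nat -> R) (n : nat) : R :=
  sigma n * Pi n / (sigma n ^+ 2 * Pi n + Delta n).

(* [E |x - R(A x + nu; g)|^2]; a constant [x] gives the expectation over the
   noise only. *)
Definition expected_sq_error (A : X -> Y) (u : nat -> X) (v : nat -> Y)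
    (x : Omega -> X) nu (g : nat -> R) : \bar R :=
  let data (w : Omega) (n : nat) : R := inner (A (x w)) (v n) + nu n w in
  (\int[P]_w sq_dist_series (x w) (reconstruction u (data w) g))%E.

End probability.

Arguments noise_sigma_algebra {R d Omega} P nu.
Arguments independent_of_noise {R X d Omega} P U nu.
Arguments signal_var {R X d Omega} P U u n.
Arguments noise_var {R d Omega} P nu n.
Arguments expected_sq_error {R X Y d Omega} P A u v x nu g.

(* Main.v *)
Require Import Defs.
From mathcomp Require Import all_boot all_order all_algebra.
From mathcomp Require Import all_classical all_reals all_analysis.
From mathcomp Require Import measurable_realfun ring.

Import Order.TTheory GRing.Theory Num.Theory.
Import numFieldNormedType.Exports.

Local Open Scope classical_set_scope.
Local Open Scope ring_scope.

(** Write [c_n = <x, u_n>] for the coefficients of the signal [x], [x_0] for its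
    projection onto the null space, [g_n] for the learned coefficients and
    [M_n = E (c_n ^ 2)].

    Since [<A x, v_n> = sigma_n c_n], the error in the direction [u_n] is
    [(1 - sigma_n g_n) c_n - g_n nu_n], and, pathwise,
    [|x - R(A x + nu; g)|^2 = |x_0|^2 + sum_n ((1 - sigma_n g_n) c_n - g_n nu_n)^2].
    This holds in the extended reals without any almost-sure qualification:
    by completeness the reconstruction series diverges exactly when the sum on
    the right is infinite ([sq_dist_seriesE]).  Taking expectations termwise
    ([expected_sq_errorE]) and subtracting [E |x_0|^2] leaves a series of
    nonnegative terms; by [(a - b)^2 <= 2 a^2 + 2 b^2] the n-th one is at most
    [2 (1 - sigma_n g_n)^2 M_n + 2 g_n^2 Delta_n] ([coef_error_le]).

    Put [t_n = Delta_n / (sigma_n^2 Pi_n + Delta_n)], a number in [0, 1].  Then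
    [1 - sigma_n g_n = t_n] and [g_n^2 Delta_n = Pi_n t_n (1 - t_n)], so that the
    n-th term is at most [2 (M_n + Pi_n)], which is summable and does not depend
    on [delta], and also at most a constant times [Delta_n <= delta^2]
    ([learned_coef_bounds]); the latter needs [M_n = 0] whenever [Pi_n = 0].
    Dominated convergence for series ([dominated_nneseries_cvg0]) concludes.

    Both claims are instances of one statement on a random signal [x]
    ([learned_error_cvg0]): the second is [x = U], with [M = Pi], and the first
    is the deterministic signal [x = u], with [M_n = <u, u_n>^2] and [x_0 = 0]. *)

(** * Orthonormal systems in a Hilbert space *)

Section inner_product.
Context {R : realType} {X : hilbertType R}.
Implicit Types (x y z : X) (S : set X).

Lemma innerC x y : inner x y = inner y x.
Proof. by rewrite hermC expr0 mul1r. Qed.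

Lemma innerBl x y z : inner (x - y) z = inner x z - inner y z.
Proof. exact: linearBl. Qed.

Lemma innerZl (a : R) x y : inner (a *: x) y = a * inner x y.
Proof. exact: linearZl_LR. Qed.

Lemma inner_suml (F : nat -> X) m n y :
  inner (\sum_(m <= i < n) F i) y = \sum_(m <= i < n) inner (F i) y.
Proof. exact: linear_sumlz. Qed.

Lemma inner_sumZr (a : nat -> R) (F : nat -> X) m n x :
  inner x (\sum_(m <= i < n) a i *: F i) =
  \sum_(m <= i < n) a i * inner x (F i).
Proof.
rewrite innerC inner_suml; apply: eq_bigr => i _.
by rewrite innerZl innerC.
Qed.

Lemma sqr_normD x y : `|x + y| ^+ 2 = `|x| ^+ 2 + `|y| ^+ 2 + inner x y *+ 2.
Proof. by rewrite -!inner_norm hnormD expr0 mul1r mulr2n. Qed.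

Lemma pythagoras x y :
  inner x y = 0 -> `|x + y| ^+ 2 = `|x| ^+ 2 + `|y| ^+ 2.
Proof. by move=> xy0; rewrite sqr_normD xy0 mul0rn addr0. Qed.

Lemma inner_eq0 x : inner x x = 0 -> x = 0.
Proof. by rewrite inner_norm => /eqP; rewrite sqrf_eq0 normr_eq0 => /eqP. Qed.

(** Polarisation expresses the inner product through the norm, whose
    continuity is known. *)
Lemma continuous_inner y : continuous (fun x => inner x y).
Proof.
move=> x.
rewrite (_ : (fun x => inner x y) =
    fun x => 2^-1 * (`|x + y| ^+ 2 - `|x| ^+ 2 - `|y| ^+ 2)); last first.
  by apply/funext => z; rewrite sqr_normD; field.
apply: cvgM; first exact: cvg_cst.
apply: cvgB; last exact: cvg_cst.
apply: cvgB; rewrite expr2; apply: cvgM; apply: cvg_norm;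
  solve [exact: cvg_id | apply: cvgD; [exact: cvg_id | exact: cvg_cst]].
Qed.

Lemma cvg_inner (z : X ^nat) x y :
  z @ \oo --> x -> (fun n => inner (z n) y) @ \oo --> inner x y.
Proof.
move=> zx.
exact: (cvg_comp z (fun w => inner w y) zx (continuous_inner y x)).
Qed.

(** The difference [p - y] of two admissible points lies both in [S] and in its
    orthogonal complement. *)
Lemma orth_projE S x p : (forall y z, S y -> S z -> S (y - z)) ->
  S p -> orth_compl S (x - p) -> orth_proj S x = p.
Proof.
move=> SB Sp xp; apply: get_unique => // y [Sy xy].
have Spy : S (p - y) by exact: SB.
apply/esym/eqP; rewrite -subr_eq0; apply/eqP/inner_eq0.
rewrite -[X in inner X _](_ : (x - y) - (x - p) = _); last first.
  by rewrite opprB addrC addrA subrK.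
by rewrite innerBl xy// xp// subr0.
Qed.

Context (e : nat -> X) (e_on : forall m n, inner (e m) (e n) = (m == n)%:R).
Implicit Types (a : nat -> R) (m n k : nat).

Lemma inner_lin_comb a m n k :
  inner (\sum_(m <= i < n) a i *: e i) (e k) = if (m <= k < n)%N then a k else 0.
Proof.
rewrite inner_suml (eq_bigr (fun i => if i == k then a i else 0)); last first.
  by move=> i _; rewrite innerZl e_on; case: eqP => _; rewrite ?mulr1 ?mulr0.
rewrite -big_mkcond/=; case: ifPn => [kmn|kmn].
  by rewrite -big_filter filter_pred1_uniq ?iota_uniq ?mem_index_iota// big_seq1.
rewrite big_seq_cond big1// => i /andP[+ /eqP ik].
by rewrite mem_index_iota ik (negbTE kmn).
Qed.

Lemma sqr_norm_lin_comb a m n :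
  `|\sum_(m <= i < n) a i *: e i| ^+ 2 = \sum_(m <= i < n) a i ^+ 2.
Proof.
rewrite -inner_norm inner_sumZr big_seq [RHS]big_seq.
apply: eq_bigr => i; rewrite mem_index_iota => imn.
by rewrite inner_lin_comb imn expr2.
Qed.

Definition fourier x : X ^nat := series (fun n => inner x (e n) *: e n).

(** Pythagoras for the partial Fourier sum of [x] and the remainder, which is
    orthogonal to the terms of that sum. *)
Lemma bessel x n : \sum_(0 <= i < n) inner x (e i) ^+ 2 <= `|x| ^+ 2.
Proof.
rewrite -[x in leRHS](subrK (fourier x n)) pythagoras.
  by rewrite sqr_norm_lin_comb lerDr sqr_ge0.
rewrite inner_sumZr big_seq big1// => k; rewrite mem_index_iota => kn.
by rewrite innerBl inner_lin_comb kn subrr mulr0.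
Qed.

(** By orthonormality the increments of the vector series have the same size
    as those of the scalar series, so the Cauchy criterion and completeness
    transfer convergence. *)
Lemma riesz_fischer a :
  cvgn (series (fun n => a n ^+ 2)) -> cvgn (series (fun n => a n *: e n)).
Proof.
move=> /cauchy_cvgP/cauchy_seriesP ca; apply/cauchy_cvgP/cauchy_seriesP => r r0.
have [|U [UF UF'] cU] := ca (r ^+ 2); first by rewrite exprn_gt0.
exists U => // n /cU /=.
rewrite ger0_norm ?sumr_ge0// => [|i _]; last exact: sqr_ge0.
by rewrite -sqr_norm_lin_comb ltr_sqr ?nnegrE// ltW.
Qed.

Lemma cvg_series_sqr a (M : R) :
  (forall n, \sum_(0 <= i < n) a i ^+ 2 <= M) -> cvgn (series (fun n => a n ^+ 2)).
Proof.
move=> aM; apply: nondecreasing_is_cvgn.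
  by apply: nondecreasing_series => n _ _; exact: sqr_ge0.
by exists M => _ [n _ <-]; exact: aM.
Qed.

Lemma is_cvg_fourier x : cvgn (fourier x).
Proof. by apply/riesz_fischer/(cvg_series_sqr _ _ (bessel x)). Qed.

Lemma inner_lim_series a k :
  cvgn (series (fun n => a n *: e n)) ->
  inner (limn (series (fun n => a n *: e n))) (e k) = a k.
Proof.
move=> ca; have /cvg_lim <-// := cvg_inner _ _ (e k) ca.
apply: lim_near_cst => //.
by exists k.+1 => // n /= kn; rewrite inner_lin_comb leq0n kn.
Qed.

Definition fourier_residual x : X := x - limn (fourier x).

Lemma inner_residual x k : inner (fourier_residual x) (e k) = 0.
Proof. by rewrite innerBl inner_lim_series ?subrr//; exact: is_cvg_fourier. Qed.

Lemma sqr_dist_partial_sum x a n :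
  `|fourier_residual x + \sum_(0 <= i < n) (inner x (e i) - a i) *: e i| ^+ 2 =
  `|fourier_residual x| ^+ 2 + \sum_(0 <= i < n) (inner x (e i) - a i) ^+ 2.
Proof.
rewrite pythagoras ?sqr_norm_lin_comb// inner_sumZr big1// => i _.
by rewrite inner_residual mulr0.
Qed.

(** Parseval, with both sides equal to [+oo] when the series diverges: a
    divergent orthogonal series has non-square-summable coefficients, and these
    stay so after adding the square-summable Fourier coefficients of [x]. *)
Lemma sq_dist_seriesE x a :
  sq_dist_series x (series (fun n => a n *: e n)) =
  ((`|fourier_residual x| ^+ 2)%:E +
   \sum_(0 <= n <oo) ((inner x (e n) - a n) ^+ 2)%:E)%E.
Proof.
set s := series _; pose b n := inner x (e n) - a n.
have sE : s = fourier x - series (fun n => b n *: e n).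
  apply/funext => n; change (s n = fourier x n - series (fun n => b n *: e n) n).
  rewrite /s /fourier !seriesEnat/= -sumrB.
  by apply: eq_bigr => i _; rewrite -scalerBl /b opprB addrC subrK.
have b0 n : (0 <= (b n ^+ 2)%:E)%E by rewrite lee_fin sqr_ge0.
rewrite /sq_dist_series; case: asboolP => cs.
  have cb : cvgn (series (fun n => b n *: e n)).
    rewrite (_ : series _ = fourier x - s); last by rewrite sE opprB addrC subrK.
    by apply: is_cvgB => //; exact: is_cvg_fourier.
  have xs : x - limn s = fourier_residual x + limn (series (fun n => b n *: e n)).
    by rewrite sE limB// ?opprD ?opprK ?addrA//; exact: is_cvg_fourier.
  rewrite xs; apply/esym.
  have : (fun n => `|fourier_residual x| ^+ 2 + \sum_(0 <= i < n) b i ^+ 2)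
      @ \oo --> `|fourier_residual x + limn (series (fun n => b n *: e n))| ^+ 2.
    under eq_fun do rewrite -sqr_dist_partial_sum expr2.
    rewrite expr2; apply: cvgM; apply: cvg_norm; apply: cvgD => //;
      exact: cvg_cst.
  move=> bcvg; rewrite -(cvg_lim _ bcvg)//.
  have cb2 : cvgn (series (fun n => b n ^+ 2)).
    rewrite (_ : series _ = (fun n => (`|fourier_residual x| ^+ 2 +
        \sum_(0 <= i < n) b i ^+ 2) - `|fourier_residual x| ^+ 2)); last first.
      by apply/funext => n; rewrite addrAC subrr add0r.
    by apply: is_cvgB; [exact: (cvgP _ bcvg) | exact: is_cvg_cst].
  have -> : limn (fun n => `|fourier_residual x| ^+ 2 +
      \sum_(0 <= i < n) b i ^+ 2) =
      `|fourier_residual x| ^+ 2 + limn (series (fun n => b n ^+ 2)).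
    by apply/cvg_lim => //; apply: cvgD => //; exact: cvg_cst.
  rewrite EFinD -EFin_lim//; congr (_ + _)%E; apply: congr_lim.
  by apply/funext => n /=; rewrite sumEFin.
(* The series diverges: a finite sum would make both series on the right of [sE]
   converge. *)
have [->|] := eqVneq (\sum_(0 <= n <oo) (b n ^+ 2)%:E)%E +oo%E.
  by rewrite addey.
rewrite -ltey => bfin; case: cs.
have -> : s = fourier x - series (fun n => b n *: e n) by [].
apply: is_cvgB; first exact: is_cvg_fourier.
apply/riesz_fischer/(cvg_series_sqr _ (fine (\sum_(0 <= n <oo) (b n ^+ 2)%:E)%E)).
move=> n; rewrite -lee_fin fineK ?ge0_fin_numE ?nneseries_ge0//.
by rewrite -sumEFin; exact: nneseries_lim_ge.
Qed.
End inner_product.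

(** * The singular system *)

Section singular_values.
Context {R : realType} {X Y : hilbertType R} {A : {linear X -> Y}}
  {sigma : nat -> R} {u : nat -> X} {v : nat -> Y}.
Context (A_sve : singular_value_expansion A sigma u v).
Implicit Types x : X.

Let u_on m n : inner (u m) (u n) = (m == n)%:R.
Proof. by case: A_sve => _ _ [+ _] _ _; exact. Qed.

Let v_on m n : inner (v m) (v n) = (m == n)%:R.
Proof. by case: A_sve => _ _ _ [+ _] _; exact. Qed.

Lemma inner_sve x n : inner (A x) (v n) = sigma n * inner x (u n).
Proof.
have Ax := @sve_expansion _ _ _ _ _ _ _ A_sve x.
rewrite -(cvg_lim _ Ax)//.
exact: (inner_lim_series v v_on (fun n => sigma n * inner x (u n)) n (cvgP _ Ax)).
Qed.

(** As [sigma n > 0], the coefficients [<A x, v n>] and [<x, u n>] vanish together,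
    and [A x] is the sum of its expansion. *)
Lemma null_spaceP x : null_space A x <-> forall n, inner x (u n) = 0.
Proof.
split=> [Ax0 n|xu0].
  have := inner_sve x n; rewrite [A x]Ax0.
  rewrite innerC -(subrr (v n)) innerC innerBl subrr => /esym/eqP.
  by rewrite mulf_eq0 gt_eqF ?(sve_pos A_sve)//= => /eqP.
rewrite /null_space /= -(cvg_lim _ (@sve_expansion _ _ _ _ _ _ _ A_sve x))//.
apply: lim_near_cst => //; apply: nearW => n.
by rewrite seriesEnat /= big1// => i _; rewrite xu0 mulr0 scale0r.
Qed.

Lemma null_spaceB x y :
  null_space A x -> null_space A y -> null_space A (x - y).
Proof. by rewrite /null_space /= linearB => -> ->; rewrite subrr. Qed.

(** The residual is orthogonal to every [u n], hence in the null space, and what is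
    subtracted is a limit of linear combinations of the [u n], hence in the closed
    span, which is the orthogonal complement of the null space. *)
Lemma orth_proj_null_spaceE x :
  orth_proj (null_space A) x = fourier_residual u x.
Proof.
apply: orth_projE; first exact: null_spaceB.
  by apply/null_spaceP => n; exact: inner_residual.
have [_ <-] := sve_basis_u A_sve.
rewrite opprB addrC subrK => B /(is_cvg_fourier u u_on x) [N _ NB].
exists (series (fun n => inner x (u n) *: u n) N); split; last exact: NB (leqnn N).
exists N, (fun n => inner x (u n)).
by rewrite seriesEord.
Qed.

Lemma orth_proj_null_space0 x :
  orth_compl (null_space A) x -> orth_proj (null_space A) x = 0.
Proof.
move=> Ax; apply: orth_projE; first exact: null_spaceB.
  by rewrite /null_space /= linear0.
by rewrite subr0.
Qed.

Lemma sq_dist_reconstructionE x c g :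
  sq_dist_series x (reconstruction u c g) =
  ((`|orth_proj (null_space A) x| ^+ 2)%:E +
   \sum_(0 <= n <oo) ((inner x (u n) - g n * c n) ^+ 2)%:E)%E.
Proof. by rewrite orth_proj_null_spaceE -sq_dist_seriesE. Qed.

(** The case of a zero reconstruction. *)
Lemma parseval x : ((`|x| ^+ 2)%:E = (`|orth_proj (null_space A) x| ^+ 2)%:E +
   \sum_(0 <= n <oo) (inner x (u n) ^+ 2)%:E)%E.
Proof.
have := sq_dist_reconstructionE x (fun=> 0) (fun=> 0).
under eq_eseriesr do rewrite mulr0 subr0.
move=> <-; rewrite /sq_dist_series.
have r0 : reconstruction u (fun=> 0) (fun=> 0 : R) @ \oo --> (0 : X).
  apply: cvg_near_cst; apply: nearW => n.
  by rewrite /reconstruction seriesEnat /= big1// => i _; rewrite mulr0 scale0r.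
by rewrite asboolT ?(cvg_lim _ r0)// ?subr0//; exact: cvgP r0.
Qed.

End singular_values.

(** * Series depending on a small parameter *)

Section series_limit.
Context {R : realType}.
Local Open Scope ereal_scope.

Lemma cvg0_of_le {T} {F : set_system T} {FF : Filter F} (f : T -> \bar R) :
  (forall eps : R, (0 < eps)%R -> \forall t \near F, 0 <= f t <= eps%:E) ->
  f @ F --> 0.
Proof.
move=> f0; apply/fine_cvgP; split.
  apply: filterS (f0 1%R ltr01) => t /andP[ft0 ft1].
  by rewrite ge0_fin_numE// (le_lt_trans ft1)// ltry.
apply/cvgrPdist_le => eps e0; apply: filterS (f0 _ e0) => t /= /andP[ft0 fte].
rewrite sub0r normrN ger0_norm ?fine_ge0// -lee_fin fineK//.
by rewrite ge0_fin_numE// (le_lt_trans fte)// ltry.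
Qed.

(** Dominated convergence for series: the tail is small uniformly in [d] and
    the remaining finitely many terms are small with [d]. *)
Lemma dominated_nneseries_cvg0 (F : R -> nat -> R) (B K : nat -> R) :
  (forall d n, 0 < d -> 0 <= F d n <= B n)%R ->
  (forall d n, 0 < d -> F d n <= K n * d ^+ 2)%R ->
  \sum_(0 <= n <oo) (B n)%:E < +oo ->
  \sum_(0 <= n <oo) (F d n)%:E @[d --> 0%R^'+] --> 0.
Proof.
move=> FB FK Boo.
have B0 n : (0 <= B n)%R.
  by have /andP[F0 F1] := FB 1%R n ltr01; exact: le_trans F0 F1.
apply: cvg0_of_le => eps e0.
have e20 : (0 < eps / 2)%R by rewrite divr_gt0.
have /fine_cvgP[tail_fin] := nneseries_tail_cvg Boo (fun n _ => B0 n).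
move=> /cvgrPdist_le/(_ _ e20) tail_le.
have [N _ /(_ N (leqnn N)) [BNfin BN]] := filterI tail_fin tail_le.
pose C := (\sum_(0 <= n < N) K n)%R.
have C0 : (d ^+ 2 * C @[d --> 0%R^'+] --> 0)%R.
  apply: cvg_at_right_filter; rewrite -[X in _ --> X](mul0r C).
  apply: cvgM; last exact: cvg_cst.
  by rewrite -[X in _ --> X](expr0n R 2); exact: exprn_continuous.
near=> d.
have d0 : (0 < d)%R by near: d; exact: nbhs_right_gt.
have Fd0 n : 0 <= (F d n)%:E by have /andP[] := FB d n d0.
rewrite nneseries_ge0//= (nneseries_split 0 N)//.
rewrite [eps]splitr EFinD leeD//.
  rewrite sumEFin lee_fin.
  apply: (@le_trans _ _ (d ^+ 2 * C)%R).
    by rewrite mulr_sumr; apply: ler_sum => n _; rewrite mulrC; exact: FK.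
  near: d; exact: cvgr_le C0 _ e20.
rewrite add0n.
apply: (@le_trans _ _ (\sum_(N <= n <oo) (B n)%:E)).
  by apply: lee_nneseries => n _ //; rewrite lee_fin; have /andP[] := FB d n d0.
rewrite -(fineK BNfin) lee_fin; apply: le_trans BN.
by rewrite sub0r normrN ler_norm.
Unshelve. all: by end_near. Qed.
End series_limit.

(** * The learned coefficients *)

Section learned_coefficients.
Context {R : realFieldType}.
Implicit Types s p q m t : R.

(** With [w = q / (s ^+ 2 * p + q)] one has [1 - s * g = w] and
    [g ^+ 2 * q = p * w * (1 - w)], where [0 <= w <= 1] and
    [w <= q / (s ^+ 2 * p)].  If [p = 0] the last bound is lost, but then
    [g = 0] and [m = 0]. *)
Lemma learned_coef_bounds s p q m t : 0 < s -> 0 <= p -> 0 <= q -> q <= t ->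
    0 <= m -> (p = 0 -> m = 0) ->
  let g := s * p / (s ^+ 2 * p + q) in
  let r := 2 * (1 - s * g) ^+ 2 * m + 2 * g ^+ 2 * q in
  0 <= r <= 2 * (m + p) /\ r <= 2 * (m / (s ^+ 2 * p) + 1 / s ^+ 2) * t.
Proof.
move=> s0 p0 q0 qt m0 pm g /=.
have gE : g = s * p / (s ^+ 2 * p + q) by [].
clearbody g.
have t0 : 0 <= t := le_trans q0 qt.
have s20 : 0 < s ^+ 2 by rewrite exprn_gt0.
have r0 : 0 <= 2 * (1 - s * g) ^+ 2 * m + 2 * g ^+ 2 * q.
  by apply: addr_ge0; apply: mulr_ge0 => //; apply: mulr_ge0; rewrite ?sqr_ge0.
rewrite r0 /=; move: p0; rewrite le_eqVlt => /predU1P[p0|p0].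
  rewrite -p0 in gE pm *; rewrite pm// gE !(mulr0, mul0r, expr0n, add0r)/=.
  by split=> //; rewrite !mulr_ge0// invr_ge0 ltW.
have sp0 : 0 < s ^+ 2 * p by rewrite mulr_gt0.
have D0 : 0 < s ^+ 2 * p + q by rewrite ltr_wpDr.
pose w := q / (s ^+ 2 * p + q).
have w0 : 0 <= w by rewrite divr_ge0// ltW.
have w1 : w <= 1 by rewrite ler_pdivrMr// mul1r lerDr ltW.
have wt : w <= t / (s ^+ 2 * p).
  by apply: ler_pM => //; [rewrite invr_ge0 ltW | rewrite lef_pV2// lerDl].
have -> : 1 - s * g = w by rewrite gE /w; field; rewrite gt_eqF.
have -> : 2 * g ^+ 2 * q = 2 * (p * (w * (1 - w))).
  by rewrite gE /w; field; rewrite gt_eqF.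
have ww : w ^+ 2 <= w by rewrite expr2 ler_piMl.
have w1w : w * (1 - w) <= w by rewrite ler_piMr// lerBlDr lerDl.
have E1 : 2 * w ^+ 2 * m + 2 * (p * (w * (1 - w))) <= 2 * ((m + p) * w).
  rewrite (_ : _ + _ = 2 * (m * w ^+ 2 + p * (w * (1 - w)))); last by ring.
  by rewrite ler_pM2l// [leRHS]mulrDl lerD// ler_wpM2l// ltW.
split; apply: (le_trans E1).
  by rewrite ler_pM2l// ler_piMr// addr_ge0// ltW.
rewrite -mulrA ler_pM2l//.
apply: (@le_trans _ _ ((m + p) * (t / (s ^+ 2 * p)))).
  by rewrite ler_wpM2l// addr_ge0// ltW.
rewrite le_eqVlt; apply/orP; left; apply/eqP; field.
by rewrite !gt_eqF.
Qed.

End learned_coefficients.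

(** * Expected squared error *)

Lemma measurable_nneseries {R : realType} {d : measure_display}
    {T : measurableType d} (h : nat -> T -> \bar R) :
  (forall n t, (0 <= h n t)%E) -> (forall n, measurable_fun setT (h n)) ->
  measurable_fun setT (fun t => \sum_(0 <= n <oo) h n t)%E.
Proof.
move=> h0 mh; rewrite (_ : (fun _ => _) =
    fun t => \sum_(0 <= n <oo | n \in xpredT) h n t)%E.
  by apply: ge0_emeasurable_sum.
by apply/funext => t; exact: eq_eseriesl.
Qed.

Section measurability.
Context {R : realType} {X : hilbertType R}.

Lemma measurable_continuous_borel (f : X -> R) : continuous f ->
  measurable_fun [set: borel X] (f : borel X -> R).
Proof.
move=> /continuousP cf; apply: (measurability _ (RGenOpens.measurableE R)).
move=> _ [_ [a [b ->] <-]]; rewrite setTI.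
by apply: sub_sigma_algebra; apply/cf/interval_open.
Qed.

Context {d : measure_display} {Omega : measurableType d}.
Context (x : Omega -> X) (x_random : random_element x).

Lemma measurable_inner_random y : measurable_fun setT (fun w => inner (x w) y).
Proof.
exact: (measurableT_comp (measurable_continuous_borel _ (continuous_inner y))).
Qed.

Lemma measurable_norm_random : measurable_fun setT (fun w => `|x w|).
Proof.
exact: (measurableT_comp (measurable_continuous_borel _ (@norm_continuous _ X))).
Qed.

End measurability.

Section error.
Context {R : realType} {X Y : hilbertType R} {A : {linear X -> Y}}
  {sigma : nat -> R} {u : nat -> X} {v : nat -> Y}.
Context (A_sve : singular_value_expansion A sigma u v).
Context {d : measure_display} {Omega : measurableType d}
  (P : probability Omega R).
Context (x : Omega -> X) (x_random : random_element x).
Context (x_sq_integrable : ('E_P[fun w => (`|x w| ^+ 2)%R] < +oo)%E).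
Local Open Scope ereal_scope.

Let mcoef n : measurable_fun setT (fun w => (inner (x w) (u n) ^+ 2)%:E).
Proof.
by apply/measurable_EFinP/measurable_funX; exact: measurable_inner_random.
Qed.

Let mnorm : measurable_fun setT (fun w => (`|x w| ^+ 2)%:E).
Proof.
by apply/measurable_EFinP/measurable_funX; exact: measurable_norm_random.
Qed.

(** The projection is defined by a choice, so its measurability is not visible from
    its definition; by Parseval its squared norm is [|x|^2 - sum_n <x, u_n>^2]. *)
Lemma measurable_orth_proj_null_space :
  measurable_fun setT
    (fun w => (`|orth_proj (null_space A) (x w)| ^+ 2)%:E).
Proof.
rewrite (_ : (fun _ => _) = fun w => (`|x w| ^+ 2)%:E -
    \sum_(0 <= n <oo) (inner (x w) (u n) ^+ 2)%:E).
  apply: emeasurable_funB => //.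
  apply: measurable_nneseries => // n w; by rewrite lee_fin sqr_ge0.
apply/funext => w; rewrite (parseval A_sve (x w)).
have : \sum_(0 <= n <oo) (inner (x w) (u n) ^+ 2)%:E \is a fin_num.
  rewrite ge0_fin_numE ?nneseries_ge0// => [|n _ _]; last first.
    by rewrite lee_fin sqr_ge0.
  apply: (@le_lt_trans _ _ (`|x w| ^+ 2)%:E); last exact: ltry.
  by rewrite (parseval A_sve) leeDr// lee_fin sqr_ge0.
by move=> sfin; rewrite addeK.
Qed.

Lemma expectation_parseval : 'E_P[fun w => (`|x w| ^+ 2)%R] =
  'E_P[fun w => (`|orth_proj (null_space A) (x w)| ^+ 2)%R] +
  \sum_(0 <= n <oo) 'E_P[fun w => (inner (x w) (u n) ^+ 2)%R].
Proof.
rewrite expectation.unlock; under eq_integral do rewrite (parseval A_sve).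
rewrite ge0_integralD//=.
- rewrite integral_nneseries => [//|//|//|n w _]; by rewrite lee_fin sqr_ge0.
- exact: measurable_orth_proj_null_space.
- by move=> w _; rewrite nneseries_ge0// => n _ _; rewrite lee_fin sqr_ge0.
- by apply: measurable_nneseries => // n w; rewrite lee_fin sqr_ge0.
Qed.

Let coef_ge0 n : 0 <= 'E_P[fun w => (inner (x w) (u n) ^+ 2)%R].
Proof. by apply: expectation_ge0 => w; exact: sqr_ge0. Qed.

Lemma summable_coef :
  \sum_(0 <= n <oo) 'E_P[fun w => (inner (x w) (u n) ^+ 2)%R] < +oo.
Proof.
apply: le_lt_trans x_sq_integrable; rewrite expectation_parseval leeDr//.
by apply: expectation_ge0 => w; exact: sqr_ge0.
Qed.

Lemma signal_varE n :
  (signal_var P x u n)%:E = 'E_P[fun w => (inner (x w) (u n) ^+ 2)%R].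
Proof.
rewrite fineK// ge0_fin_numE//; apply: le_lt_trans summable_coef.
rewrite (@nneseriesD1 _ _ n)//; apply: leeDl; exact: nneseries_ge0.
Qed.

Lemma signal_var_ge0 n : (0 <= signal_var P x u n)%R.
Proof. by rewrite -lee_fin signal_varE. Qed.

Context (nu : nat -> {RV P >-> R}) (g : nat -> R).

Definition coef_error n w : R :=
  (inner (x w) (u n) - g n * (inner (A (x w)) (v n) + nu n w))%R.

Let mcoef_error n : measurable_fun setT (fun w => (coef_error n w ^+ 2)%:E).
Proof.
apply/measurable_EFinP/measurable_funX; rewrite /coef_error.
under eq_fun do rewrite (inner_sve A_sve).
apply: measurable_funB; first exact: measurable_inner_random.
apply: measurable_funM => //; apply: measurable_funD => //.
by apply: measurable_funM => //; exact: measurable_inner_random.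
Qed.

Lemma expected_sq_errorE : expected_sq_error P A u v x nu g =
  'E_P[fun w => (`|orth_proj (null_space A) (x w)| ^+ 2)%R] +
  \sum_(0 <= n <oo) 'E_P[fun w => (coef_error n w ^+ 2)%R].
Proof.
rewrite /expected_sq_error.
under eq_integral do rewrite (sq_dist_reconstructionE A_sve).
rewrite expectation.unlock ge0_integralD//=.
- rewrite integral_nneseries => [//|//|//|n w _]; by rewrite lee_fin sqr_ge0.
- exact: measurable_orth_proj_null_space.
- by move=> w _; rewrite nneseries_ge0// => n _ _; rewrite lee_fin sqr_ge0.
- by apply: measurable_nneseries => // n w; rewrite lee_fin sqr_ge0.
Qed.

(** By [(a - b)^2 <= 2 a^2 + 2 b^2], the difference of the two sides being
    [(a + b)^2]. *)
Lemma coef_error_le n :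
  'E_P[fun w => (coef_error n w ^+ 2)%R] <=
  (2 * (1 - sigma n * g n) ^+ 2)%:E * (signal_var P x u n)%:E +
  (2 * g n ^+ 2)%:E * noise_var P nu n.
Proof.
rewrite signal_varE /noise_var expectation.unlock.
have mnu : measurable_fun setT (fun w => (nu n w ^+ 2)%:E).
  by apply/measurable_EFinP/measurable_funX.
have a0 : (0 <= 2 * (1 - sigma n * g n) ^+ 2)%R by rewrite mulr_ge0// sqr_ge0.
have b0 : (0 <= 2 * g n ^+ 2)%R by rewrite mulr_ge0// sqr_ge0.
rewrite -!ge0_integralZl//=; last 2 first.
- by move=> w _; rewrite lee_fin sqr_ge0.
- by move=> w _; rewrite lee_fin sqr_ge0.
rewrite -ge0_integralD//=; last 4 first.
- by move=> w _; apply: mule_ge0; rewrite lee_fin ?sqr_ge0.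
- exact: measurable_funeM.
- by move=> w _; apply: mule_ge0; rewrite lee_fin ?sqr_ge0.
- exact: measurable_funeM.
apply: ge0_le_integral => //.
- by move=> w _; rewrite lee_fin sqr_ge0.
- by apply: emeasurable_funD; exact: measurable_funeM.
move=> w _; rewrite -!EFinM -EFinD lee_fin /coef_error (inner_sve A_sve).
set c := inner _ _; set z := nu n w; rewrite -subr_ge0.
rewrite [leRHS](_ : _ = (((1 - sigma n * g n) * c + g n * z) ^+ 2)%R) ?sqr_ge0//.
by ring.
Qed.

End error.

(** * Convergence of the learned reconstruction *)

Section convergence.
Context {R : realType} {X Y : hilbertType R} {A : {linear X -> Y}}
  {sigma : nat -> R} {u : nat -> X} {v : nat -> Y}.
Context (A_sve : singular_value_expansion A sigma u v).
Context {d : measure_display} {Omega : measurableType d}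
  (P : probability Omega R).
Context (x : Omega -> X) (x_random : random_element x).
Context (x_sq_integrable : ('E_P[fun w => (`|x w| ^+ 2)%R] < +oo)%E).
Context (nu : R -> nat -> {RV P >-> R}).
Context (nu_level : forall delta : R, 0 < delta ->
      ereal_sup (range (noise_var P (nu delta))) = (delta ^+ 2)%:E).

Lemma noise_var_ge0 delta n : (0 <= noise_var P (nu delta) n)%E.
Proof. by apply: expectation_ge0 => w; exact: sqr_ge0. Qed.

Lemma noise_var_le delta n : 0 < delta ->
  (noise_var P (nu delta) n <= (delta ^+ 2)%:E)%E.
Proof. by move=> d0; rewrite -nu_level//; apply: ereal_sup_ubound; exists n. Qed.

Lemma noise_varE delta n : 0 < delta ->
  noise_var P (nu delta) n = (fine (noise_var P (nu delta) n))%:E.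
Proof.
move=> d0; rewrite fineK// ge0_fin_numE ?noise_var_ge0//.
exact: le_lt_trans (noise_var_le _ n d0) (ltry _).
Qed.

(** The signal [x] to be reconstructed may be distributed differently from the one
    for which the coefficients were learned; its coefficients only have to vanish
    almost surely in the modes with [Pi n = 0], which the learned reconstruction
    discards. *)
Lemma learned_error_cvg0 (Pi : nat -> R) :
  (forall n, 0 <= Pi n) -> (\sum_(0 <= n <oo) (Pi n)%:E < +oo)%E ->
  (forall n, Pi n = 0 -> signal_var P x u n = 0) ->
  (expected_sq_error P A u v x (nu delta)
     (learned_coef sigma Pi (fine \o noise_var P (nu delta))) -
   'E_P[fun w => (`|orth_proj (null_space A) (x w)| ^+ 2)%R])%E
    @[delta --> 0^'+] --> 0%E.
Proof.
move=> Pi0 Pioo PiM.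
pose M n := signal_var P x u n.
pose D delta n := fine (noise_var P (nu delta) n).
pose g delta := learned_coef sigma Pi (D delta).
pose F delta n := 2 * (1 - sigma n * g delta n) ^+ 2 * M n
  + 2 * g delta n ^+ 2 * D delta n.
have M0 n : 0 <= M n by exact: (signal_var_ge0 A_sve P x x_random x_sq_integrable).
have bounds delta n : 0 < delta -> 0 <= F delta n <= 2 * (M n + Pi n) /\
    F delta n <= 2 * (M n / (sigma n ^+ 2 * Pi n) + 1 / sigma n ^+ 2) * delta ^+ 2.
  move=> d0; apply: learned_coef_bounds => //; last 2 first.
  - by rewrite -lee_fin -noise_varE// noise_var_le.
  - exact: PiM.
  - exact: sve_pos A_sve n.
  - by rewrite fine_ge0// noise_var_ge0.
have Fcvg : (\sum_(0 <= n <oo) (F delta n)%:E)%E @[delta --> 0^'+] --> 0%E.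
  apply: dominated_nneseries_cvg0.
  - by move=> delta n /bounds - /(_ n)[+ _]; exact.
  - by move=> delta n /bounds - /(_ n)[_ +]; exact.
  under eq_eseriesr do rewrite EFinM.
  rewrite nneseriesZl//; last by move=> n _; rewrite lee_fin addr_ge0.
  under eq_eseriesr do rewrite EFinD.
  rewrite nneseriesD; last 2 first.
  - by move=> n _ _; rewrite lee_fin.
  - by move=> n _ _; rewrite lee_fin.
  rewrite lte_mul_pinfty// lte_add_pinfty//.
  under eq_eseriesr do rewrite (signal_varE A_sve P x x_random x_sq_integrable).
  exact: (summable_coef A_sve).
have x0fin :
    ('E_P[fun w => (`|orth_proj (null_space A) (x w)| ^+ 2)%R] \is a fin_num)%E.
  rewrite ge0_fin_numE; last by apply: expectation_ge0 => w; exact: sqr_ge0.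
  apply: le_lt_trans x_sq_integrable.
  rewrite (expectation_parseval A_sve P x x_random) leeDl//.
  apply: nneseries_ge0 => n _ _.
  by apply: expectation_ge0 => w; exact: sqr_ge0.
apply: (squeeze_cvge _ (cvg_cst 0%E) Fcvg).
near=> delta.
have d0 : 0 < delta by near: delta; exact: nbhs_right_gt.
rewrite (expected_sq_errorE A_sve)// addeAC subee// add0e.
apply/andP; split.
  by apply: nneseries_ge0 => n _ _; apply: expectation_ge0 => w; exact: sqr_ge0.
apply: lee_nneseries => [n _ _|n _].
  by apply: expectation_ge0 => w; exact: sqr_ge0.
rewrite /F EFinD !EFinM -(noise_varE _ n d0).
by rewrite -!EFinM; exact: (coef_error_le A_sve).
Unshelve. all: by end_near. Qed.

End convergence.

Theorem theorem3 (R : realType) (X Y : hilbertType R)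
    (A : {linear X -> Y}) (sigma : nat -> R) (u_ : nat -> X) (v_ : nat -> Y)
    (d : measure_display) (Omega : measurableType d) (P : probability Omega R)
    (U : Omega -> X) (nu : R -> nat -> {RV P >-> R})
    (X_infinite : infinite_dimensional [set: X])
    (Y_infinite : infinite_dimensional [set: Y])
    (A_compact : compact_operator A)
    (A_infinite : infinite_dimensional (range A))
    (A_sve : singular_value_expansion A sigma u_ v_)
    (U_random : random_element U)
    (U_sq_integrable : ('E_P[fun w => (`|U w| ^+ 2)%R] < +oo)%E)
    (nu_indep : forall delta : R, 0 < delta ->
      independent_of_noise P U (nu delta))
    (nu_mean : forall (delta : R) (n : nat), 0 < delta ->
      ('E_P[nu delta n] = 0)%E)
    (nu_level : forall delta : R, 0 < delta ->
      ereal_sup (range (noise_var P (nu delta))) = (delta ^+ 2)%:E)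
    (var_pos : forall (delta : R) (n : nat), 0 < delta ->
      0 < signal_var P U u_ n \/ 0 < fine (noise_var P (nu delta) n)) :
  let g (delta : R) :=
    learned_coef sigma (signal_var P U u_) (fine \o noise_var P (nu delta)) in
  (forall u : X, orth_compl (null_space A) u ->
     (forall n, signal_var P U u_ n = 0 -> inner u (u_ n) = 0) ->
     expected_sq_error P A u_ v_ (fun=> u) (nu delta) (g delta)
       @[delta --> 0^'+] --> 0%E)
  /\
  ((expected_sq_error P A u_ v_ U (nu delta) (g delta)
      - 'E_P[fun w => (`|orth_proj (null_space A) (U w)| ^+ 2)%R])%E
     @[delta --> 0^'+] --> 0%E).
Proof.
move=> g.
have Pi0 := signal_var_ge0 A_sve P U U_random U_sq_integrable.
have Pioo : (\sum_(0 <= n <oo) (signal_var P U u_ n)%:E < +oo)%E.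
  under eq_eseriesr do rewrite (signal_varE A_sve P U U_random U_sq_integrable).
  exact: (summable_coef A_sve).
split=> [u uA uPi|]; last exact: (learned_error_cvg0 A_sve).
have u_random : random_element (fun _ : Omega => u) by exact: measurable_cst.
have u_sq_integrable : ('E_P[fun=> (`|u| ^+ 2)%R] < +oo)%E.
  by rewrite expectation_cst ltry.
have uM n : signal_var P U u_ n = 0 -> signal_var P (fun=> u) u_ n = 0.
  by move=> /uPi un0; rewrite /signal_var un0 expectation_cst expr0n.
have := learned_error_cvg0 A_sve P _ u_random u_sq_integrable nu nu_level
  _ Pi0 Pioo uM.
rewrite (orth_proj_null_space0 _ uA) normr0 expr0n expectation_cst.
by under eq_fun do rewrite sube0.
Qed.
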